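(* Assume $V \models \mathsf{ZF}^-$. Then for no formula $\varphi(x,y,z)$ and no parameter $p$ does $\{(x,y) : \varphi(x,y,p)\}$ define a non-trivial, cofinal, elementary embedding $j : V \to V$ (i.e. there is no such embedding definable from parameters; this is a scheme, one statement for each formula $\varphi$).
   Context: $\mathsf{ZF}^-$ denotes $\mathsf{ZF}$ without the Power Set axiom, with the Collection Scheme (and Replacement, Separation, Foundation schemes, Empty Set, Extensionality, Pairing, Union, Infinity). An embedding $j : M \to N$ is cofinal if for every $y \in N$ there is $x \in M$ with $y \in j(x)$. Non-trivial means not the identity. *)

(* Defs.v *)
(* Formulas of the language {∈, =}, variables as de Bruijn indices. *)
Inductive form : Type :=
  | FIn  : nat -> nat -> form
  | FEq  : nat -> nat -> form
  | FNeg : form -> form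
  | FAnd : form -> form -> form
  | FAll : form -> form.             (* ∀ v_0, binds index 0 *)

Definition scons {M : Type} (x : M) (rho : nat -> M) : nat -> M :=
  fun n => match n with 0 => x | S k => rho k end.

Fixpoint sat {M : Type} (E : M -> M -> Prop) (rho : nat -> M) (f : form) : Prop :=
  match f with
  | FIn i j => E (rho i) (rho j)
  | FEq i j => rho i = rho j
  | FNeg g => ~ sat E rho g
  | FAnd g h => sat E rho g /\ sat E rho h
  | FAll g => forall x : M, sat E (scons x rho) g
  end.

Record ZFminus (M : Type) (E : M -> M -> Prop) : Prop := {
  zf_ext : forall a b : M, (forall z, E z a <-> E z b) -> a = b;
  zf_empty : exists e : M, forall z, ~ E z e;
  zf_pair : forall a b : M, exists c, E a c /\ E b c;
  zf_union : forall a : M, exists u, forall y z, E z y -> E y a -> E z u;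
  zf_inf : exists w : M,
      (exists e, E e w /\ forall z, ~ E z e) /\
      (forall x, E x w -> exists s, E s w /\ forall z, E z s <-> (E z x \/ z = x));
  zf_sep : forall (phi : form) (rho : nat -> M) (a : M),
      exists b, forall x, E x b <-> (E x a /\ sat E (scons x rho) phi);
  zf_repl : forall (phi : form) (rho : nat -> M) (a : M),
      (forall x, E x a -> exists y, sat E (scons y (scons x rho)) phi /\
          forall y', sat E (scons y' (scons x rho)) phi -> y' = y) ->
      exists b, forall y, E y b <->
          (exists x, E x a /\ sat E (scons y (scons x rho)) phi);
  zf_coll : forall (phi : form) (rho : nat -> M) (a : M),
      (forall x, E x a -> exists y, sat E (scons y (scons x rho)) phi) ->
      exists b, forall x, E x a -> exists y, E y b /\ sat E (scons y (scons x rho)) phi;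
  zf_found : forall (phi : form) (rho : nat -> M),
      (exists x, sat E (scons x rho) phi) ->
      exists x, sat E (scons x rho) phi /\
        forall y, E y x -> ~ sat E (scons y rho) phi
}.

(* The class {(x,y) : phi(x,y,p)} : variables v0, v1, v2 are x, y, z := p;
   any further free variables are also interpreted as p. *)
Definition defrel {M : Type} (E : M -> M -> Prop) (phi : form) (p : M) (x y : M) : Prop :=
  sat E (scons x (scons y (fun _ => p))) phi.

Definition is_function {M : Type} (R : M -> M -> Prop) : Prop :=
  forall x, exists y, R x y /\ forall y', R x y' -> y' = y.

Definition elementary {M : Type} (E : M -> M -> Prop) (R : M -> M -> Prop) : Prop :=
  forall (psi : form) (rho sigma : nat -> M),
    (forall n, R (rho n) (sigma n)) -> (sat E rho psi <-> sat E sigma psi).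

Definition cofinal {M : Type} (E : M -> M -> Prop) (R : M -> M -> Prop) : Prop :=
  forall y, exists x jx, R x jx /\ E y jx.

Definition nontrivial {M : Type} (R : M -> M -> Prop) : Prop :=
  exists x jx, R x jx /\ jx <> x.

(* Main.v *)
(** Suppose some [q] makes [phi(x,y,q)] define a non-trivial cofinal elementary
    embedding [j_q].  By Gaifman's argument, a cofinal class function preserving
    finitely many suitable operations on sets is already fully elementary, so "[q]
    is such a parameter" is expressed by a single formula [Gamma(q)].  Hence the class
    [W] of sets moved by some [j_q] with [Gamma(q)] is definable without parameters.
    Take an [∈]-minimal [x] in [W], moved by [j = j_q].  Since "[x] is disjoint from
    [W]" is preserved, [j x] is disjoint from [W], so [j] fixes all elements of [x] and
    of [j x]; therefore [x] and [j x] have the same elements, a contradiction.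

    Gaifman's argument: call a class [Q] good if [j (A ∩ Q) = j A ∩ Q] for all sets
    [A].  Good classes are closed under Boolean operations and, by Collection and
    cofinality, under existential quantification.  Coding assignments by nested pairs
    [(x0, (x1, ...))], the class of codes satisfying a given formula is good. *)

From Stdlib Require Import Classical Lia.
Require Import Defs.

(** * Predicates definable by formulas, and their closure properties *)

Section Definability.
Context {M : Type} (E : M -> M -> Prop).

Lemma sat_ext (f : form) (rho sigma : nat -> M) :
  (forall n, rho n = sigma n) -> (sat E rho f <-> sat E sigma f).
Proof.
  revert rho sigma.
  induction f as [i j|i j|g IH|g IHg h IHh|g IH]; intros rho sigma H; simpl.
  - now rewrite !H.
  - now rewrite !H.
  - now rewrite (IH _ _ H).
  - now rewrite (IHg _ _ H), (IHh _ _ H).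
  - assert (K : forall x, sat E (scons x rho) g <-> sat E (scons x sigma) g)
      by (intros x; apply IH; intros [|n]; simpl; auto).
    split; intros A x; apply K, A.
Qed.

Definition up (f : nat -> nat) (n : nat) : nat :=
  match n with 0 => 0 | S m => S (f m) end.

Fixpoint ren (f : nat -> nat) (psi : form) : form :=
  match psi with
  | FIn i j => FIn (f i) (f j)
  | FEq i j => FEq (f i) (f j)
  | FNeg g => FNeg (ren f g)
  | FAnd g h => FAnd (ren f g) (ren f h)
  | FAll g => FAll (ren (up f) g)
  end.

Lemma sat_ren (psi : form) (f : nat -> nat) (rho : nat -> M) :
  sat E rho (ren f psi) <-> sat E (fun n => rho (f n)) psi.
Proof.
  revert f rho.
  induction psi as [i j|i j|g IH|g IHg h IHh|g IH]; intros f rho; simpl.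
  - tauto.
  - tauto.
  - now rewrite IH.
  - now rewrite IHg, IHh.
  - assert (K : forall x, sat E (scons x rho) (ren (up f) g) <->
                          sat E (scons x (fun n => rho (f n))) g).
    { intros x. rewrite IH. apply sat_ext. now intros [|n]. }
    split; intros A x; apply K, A.
Qed.

(** A semantic notion: the closure lemmas below assemble the formulas, so that none has to be
    written out with de Bruijn indices. *)
Definition definable (P : (nat -> M) -> Prop) : Prop :=
  exists psi, forall rho, sat E rho psi <-> P rho.

Lemma definable_ext (P Q : (nat -> M) -> Prop) :
  (forall rho, P rho <-> Q rho) -> definable P -> definable Q.
Proof.
  intros H [psi K]. exists psi. intros rho. now rewrite K.
Qed.

Lemma definable_in (i j : nat) : definable (fun rho => E (rho i) (rho j)).
Proof. exists (FIn i j). now simpl. Qed.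

Lemma definable_eq (i j : nat) : definable (fun rho => rho i = rho j).
Proof. exists (FEq i j). now simpl. Qed.

Lemma definable_not (P : (nat -> M) -> Prop) :
  definable P -> definable (fun rho => ~ P rho).
Proof.
  intros [f Hf]. exists (FNeg f). intros rho. simpl. now rewrite Hf.
Qed.

Lemma definable_and (P Q : (nat -> M) -> Prop) :
  definable P -> definable Q -> definable (fun rho => P rho /\ Q rho).
Proof.
  intros [f Hf] [g Hg]. exists (FAnd f g). intros rho. simpl. now rewrite Hf, Hg.
Qed.

Lemma definable_all (P : M -> (nat -> M) -> Prop) :
  definable (fun rho => P (rho 0) (fun n => rho (S n))) ->
  definable (fun rho => forall x, P x rho).
Proof.
  intros [f Hf]. exists (FAll f). intros rho. simpl.
  split; intros H x; apply (Hf (scons x rho)), H.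
Qed.

Lemma definable_imp (P Q : (nat -> M) -> Prop) :
  definable P -> definable Q -> definable (fun rho => P rho -> Q rho).
Proof.
  intros HP HQ. apply (definable_ext (fun rho => ~ (P rho /\ ~ Q rho))).
  - intros rho. tauto.
  - auto using definable_not, definable_and.
Qed.

Lemma definable_or (P Q : (nat -> M) -> Prop) :
  definable P -> definable Q -> definable (fun rho => P rho \/ Q rho).
Proof.
  intros HP HQ. apply (definable_ext (fun rho => ~ (~ P rho /\ ~ Q rho))).
  - intros rho. tauto.
  - auto using definable_not, definable_and.
Qed.

Lemma definable_iff (P Q : (nat -> M) -> Prop) :
  definable P -> definable Q -> definable (fun rho => P rho <-> Q rho).
Proof. intros HP HQ. apply definable_and; now apply definable_imp. Qed.

Lemma definable_ex (P : M -> (nat -> M) -> Prop) :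
  definable (fun rho => P (rho 0) (fun n => rho (S n))) ->
  definable (fun rho => exists x, P x rho).
Proof.
  intros HP. apply (definable_ext (fun rho => ~ forall x, ~ P x rho)).
  - intros rho. split.
    + intros H. apply NNPP. intros N. apply H. intros x Hx. apply N. now exists x.
    + intros [x Hx] H. exact (H x Hx).
  - apply definable_not, (definable_all (fun x rho => ~ P x rho)).
    now apply (definable_not (fun rho => P (rho 0) (fun n => rho (S n)))).
Qed.

Lemma definable_ren (f : nat -> nat) (P : (nat -> M) -> Prop) :
  definable P -> definable (fun rho => P (fun n => rho (f n))).
Proof.
  intros [psi H]. exists (ren f psi). intros rho. now rewrite sat_ren.
Qed.

Lemma definable_ren1 (P : M -> Prop) (i : nat) :
  definable (fun rho => P (rho 0)) -> definable (fun rho => P (rho i)).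
Proof. exact (definable_ren (fun _ => i) _). Qed.

Lemma definable_ren2 (P : M -> M -> Prop) (i j : nat) :
  definable (fun rho => P (rho 0) (rho 1)) ->
  definable (fun rho => P (rho i) (rho j)).
Proof. exact (definable_ren (fun n => match n with 0 => i | _ => j end) _). Qed.

Lemma definable_ren3 (P : M -> M -> M -> Prop) (i j k : nat) :
  definable (fun rho => P (rho 0) (rho 1) (rho 2)) ->
  definable (fun rho => P (rho i) (rho j) (rho k)).
Proof.
  exact (definable_ren (fun n => match n with 0 => i | 1 => j | _ => k end) _).
Qed.

(** The renaming sends every index from 2 on to [k], matching the convention of [defrel] that all
    further variables denote the parameter. *)
Lemma definable_defrel (phi : form) (k i j : nat) :
  definable (fun rho => defrel E phi (rho k) (rho i) (rho j)).
Proof.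
  exists (ren (fun n => match n with 0 => i | 1 => j | _ => k end) phi).
  intros rho. rewrite sat_ren. apply sat_ext. now intros [|[|n]].
Qed.

End Definability.

Ltac definability :=
  repeat (cbv beta;
    first [ assumption
          | apply definable_in | apply definable_eq | apply definable_defrel
          | match goal with
            | |- definable _ (fun rho => forall x : ?M, @?P rho x) =>
                apply (definable_all _ (fun x rho => P rho x))
            | |- definable _ (fun rho => exists x : ?M, @?P rho x) =>
                apply (definable_ex _ (fun x rho => P rho x))
            | |- definable _ (fun rho => ~ _) => apply definable_not
            | |- definable _ (fun rho => _ <-> _) => apply definable_iff
            | |- definable _ (fun rho => _ /\ _) => apply definable_and
            | |- definable _ (fun rho => _ \/ _) => apply definable_or
            | |- definable _ (fun rho => _ -> _) => apply definable_imp
            end ]).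

(** * Axiom schemes for definable classes, and Kuratowski pairs *)

Section SetTheory.
Context {M : Type} {E : M -> M -> Prop} (HZF : ZFminus M E).

Definition is_upair (z x y : M) : Prop := forall w, E w z <-> w = x \/ w = y.

Definition is_opair (u x y : M) : Prop :=
  forall z, E z u <-> is_upair z x x \/ is_upair z x y.

Definition is_inter (C A : M) (Q : M -> Prop) : Prop :=
  forall t, E t C <-> E t A /\ Q t.

Lemma definable_opair (i j k : nat) :
  definable E (fun rho => is_opair (rho i) (rho j) (rho k)).
Proof. unfold is_opair, is_upair. definability. Qed.

Lemma inter_exists (Q : M -> Prop) (A : M) :
  definable E (fun rho => Q (rho 0)) -> exists C, is_inter C A Q.
Proof.
  intros [psi H]. destruct (zf_sep _ _ HZF psi (fun _ => A) A) as [C HC].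
  exists C. intros t. rewrite HC, H. simpl. tauto.
Qed.

Lemma collection (P : M -> M -> Prop) (A : M) :
  definable E (fun rho => P (rho 0) (rho 1)) ->
  (forall t, E t A -> exists u, P t u) ->
  exists B, forall t, E t A -> exists u, E u B /\ P t u.
Proof.
  intros HP H.
  (* The Collection scheme reads the witness at index 0 and the element of [A] at index 1, hence the
     swap. *)
  apply (definable_ren2 _ P 1 0) in HP. destruct HP as [psi K].
  destruct (zf_coll _ _ HZF psi (fun _ => A) A) as [B HB].
  - intros t Ht. destruct (H t Ht) as [u Hu]. exists u. now apply K.
  - exists B. intros t Ht. destruct (HB t Ht) as [u [Hu Hs]].
    exists u. split; [exact Hu|]. now apply K in Hs.
Qed.

Lemma foundation (Q : M -> Prop) :
  definable E (fun rho => Q (rho 0)) -> (exists x, Q x) ->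
  exists x, Q x /\ forall y, E y x -> ~ Q y.
Proof.
  intros [psi K] [x0 H0].
  destruct (zf_found _ _ HZF psi (fun _ => x0)) as [x [Hx Hm]].
  - exists x0. now apply K.
  - exists x. split; [now apply K in Hx|].
    intros y Hy Q1. apply (Hm y Hy). now apply K.
Qed.

Lemma upair_exists (x y : M) : exists z, is_upair z x y.
Proof.
  destruct (zf_pair _ _ HZF x y) as [c [Hx Hy]].
  assert (D : definable E (fun rho => rho 0 = rho 1 \/ rho 0 = rho 2))
    by definability.
  destruct D as [psi K].
  destruct (zf_sep _ _ HZF psi (scons x (fun _ => y)) c) as [z Hz].
  exists z. intros w. rewrite Hz, K. simpl.
  split; [tauto|]. intros [->| ->]; auto.
Qed.

Lemma upair_unique (z z' x y : M) : is_upair z x y -> is_upair z' x y -> z = z'.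
Proof.
  intros H H'. apply (zf_ext _ _ HZF). intros w. now rewrite (H w), (H' w).
Qed.

Lemma opair_exists (x y : M) : exists u, is_opair u x y.
Proof.
  destruct (upair_exists x x) as [a Ha], (upair_exists x y) as [b Hb].
  destruct (upair_exists a b) as [u Hu].
  exists u. intros z. rewrite (Hu z). split.
  - intros [->| ->]; auto.
  - intros [H|H]; [left|right]; eauto using upair_unique.
Qed.

Lemma upair_inj_r (z x y y' : M) : is_upair z x y -> is_upair z x y' -> y = y'.
Proof.
  intros H H'.
  assert (A := proj1 (H' y) (proj2 (H y) (or_intror eq_refl))).
  assert (B := proj1 (H y') (proj2 (H' y') (or_intror eq_refl))).
  destruct A, B; congruence.
Qed.

Lemma opair_inj (u x y x' y' : M) :
  is_opair u x y -> is_opair u x' y' -> x = x' /\ y = y'.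
Proof.
  intros H H'.
  assert (Hx : x = x').
  { destruct (upair_exists x x) as [a Ha].
    assert (Hau : E a u) by (apply H; auto).
    apply H' in Hau.
    assert (E x' a) by (destruct Hau as [K|K]; apply K; auto).
    symmetry. destruct (proj1 (Ha x') H0); auto. }
  subst x'. split; [reflexivity|].
  destruct (upair_exists x y) as [b Hb], (upair_exists x y') as [b' Hb'].
  assert (K : E b u) by (apply H; auto).
  assert (K' : E b' u) by (apply H'; auto).
  apply H' in K. apply H in K'.
  destruct K as [K|K]; [|eauto using upair_inj_r].
  destruct K' as [K'|K']; [|symmetry; eauto using upair_inj_r].
  (* The degenerate case is left: both unordered pairs are the singleton of [x]. *)
  transitivity x.
  - eauto using upair_inj_r.
  - symmetry. eauto using upair_inj_r.
Qed.

(** Used to enlarge a set obtained from Collection by a set obtained from cofinality. *)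
Lemma superset_exists (a b : M) :
  exists c, (forall z, E z a -> E z c) /\ (forall z, E z b -> E z c).
Proof.
  destruct (zf_pair _ _ HZF a b) as [p [Ha Hb]].
  destruct (zf_union _ _ HZF p) as [c Hc].
  exists c. split; intros z Hz; eauto.
Qed.

(** * Codes of assignments *)

(** The modal operator with accessibility relation [g]; the only form of quantification that the
    goodness argument has to treat. *)
Definition diamond (g : M -> M -> Prop) (Q : M -> Prop) (t : M) : Prop :=
  exists u, g t u /\ Q u.

Lemma definable_diamond (g : M -> M -> Prop) (Q : M -> Prop) :
  definable E (fun rho => g (rho 0) (rho 1)) ->
  definable E (fun rho => Q (rho 0)) ->
  definable E (fun rho => diamond g Q (rho 0)).
Proof.
  intros Hg HQ. unfold diamond.
  apply (definable_ex _ (fun u rho => g (rho 0) u /\ Q u)), definable_and.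
  - now apply (definable_ren2 _ g 1 0).
  - exact HQ.
Qed.

(** Prepends an arbitrary entry to a code, so that [diamond ext_rel] acts as an existential
    quantifier. *)
Definition ext_rel (t u : M) : Prop := exists x, is_opair u x t.

(* [(y, (x, e)) ↦ (y, e)] *)
Definition drop_rel (t u : M) : Prop :=
  exists y x e s, is_opair t y s /\ is_opair s x e /\ is_opair u y e.

Definition mem_rel (t u : M) : Prop :=
  exists x y e, is_opair t x e /\ is_opair u y e /\ E x y.

(* Does not constrain the target: [diamond head_rel] of the universe is the class of all
   [(x, (x, e))]. *)
Definition head_rel (t u : M) : Prop :=
  exists x e s, is_opair t x s /\ is_opair s x e.

Lemma definable_ext_rel (i j : nat) : definable E (fun rho => ext_rel (rho i) (rho j)).
Proof. unfold ext_rel, is_opair, is_upair. definability. Qed.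

Lemma definable_drop_rel (i j : nat) : definable E (fun rho => drop_rel (rho i) (rho j)).
Proof. unfold drop_rel, is_opair, is_upair. definability. Qed.

Lemma definable_mem_rel (i j : nat) : definable E (fun rho => mem_rel (rho i) (rho j)).
Proof. unfold mem_rel, is_opair, is_upair. definability. Qed.

Lemma definable_head_rel (i j : nat) : definable E (fun rho => head_rel (rho i) (rho j)).
Proof. unfold head_rel, is_opair, is_upair. definability. Qed.

(* The class of pairs [(x, e)] such that [x] is the [n]-th entry of [e]. *)
Fixpoint entry_class (n : nat) : M -> Prop :=
  match n with
  | 0 => diamond head_rel (fun _ => True)
  | S m => diamond drop_rel (entry_class m)
  end.

(* The class of codes of assignments satisfying a formula, built only from Boolean
   operations and [diamond] so that goodness is inherited step by step. *)
Fixpoint code_sat (f : form) : M -> Prop :=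
  match f with
  | FIn i j => diamond ext_rel
                 (fun t => entry_class i t /\ diamond mem_rel (entry_class j) t)
  | FEq i j => diamond ext_rel (fun t => entry_class i t /\ entry_class j t)
  | FNeg g => fun t => ~ code_sat g t
  | FAnd g h => fun t => code_sat g t /\ code_sat h t
  | FAll g => fun t => ~ diamond ext_rel (fun u => ~ code_sat g u) t
  end.

Fixpoint entry (n : nat) (e x : M) : Prop :=
  match n with
  | 0 => exists e', is_opair e x e'
  | S m => exists z e', is_opair e z e' /\ entry m e' x
  end.

Definition codes (k : nat) (e : M) (rho : nat -> M) : Prop :=
  forall i, i < k -> entry i e (rho i).

Lemma entry_unique (n : nat) (e x x' : M) : entry n e x -> entry n e x' -> x = x'.
Proof.
  revert e. induction n as [|n IH]; simpl.
  - intros e [a Ha] [b Hb]. now destruct (opair_inj _ _ _ _ _ Ha Hb).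
  - intros e (z & a & Ha & H) (z' & b & Hb & H').
    destruct (opair_inj _ _ _ _ _ Ha Hb) as [_ ->]. eauto.
Qed.

(** Each [drop_rel] step deletes the first entry of [e] and keeps the candidate [x] in front; after
    [n] steps [head_rel] compares [x] with the entry that has become first. *)
Lemma entry_classE (n : nat) (t x e : M) :
  is_opair t x e -> (entry_class n t <-> entry n e x).
Proof.
  revert t e. induction n as [|n IH]; intros t e Ht; simpl; split.
  - intros (_ & (x' & e' & s & Ht' & Hs) & _).
    destruct (opair_inj _ _ _ _ _ Ht Ht') as [-> ->]. eauto.
  - intros [e' He]. exists t. split; [|exact I]. exists x, e', e. auto.
  - intros (u & (y & z & e' & s & Ht' & Hs & Hu) & H).
    destruct (opair_inj _ _ _ _ _ Ht Ht') as [-> ->].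
    exists z, e'. split; [exact Hs|]. now apply (IH u).
  - intros (z & e' & He & H). destruct (opair_exists x e') as [u Hu].
    exists u. split.
    + exists x, z, e', e. auto.
    + now apply (IH u e').
Qed.

Lemma codes_exists (k : nat) (rho : nat -> M) : exists e, codes k e rho.
Proof.
  revert rho. induction k as [|k IH]; intros rho.
  (* Any set codes zero entries. *)
  - exists (rho 0). intros i Hi. lia.
  - destruct (IH (fun n => rho (S n))) as [e' He'].
    destruct (opair_exists (rho 0) e') as [e He]. exists e.
    intros [|i] Hi; simpl; [eauto|].
    exists (rho 0), e'. split; [exact He|]. apply He'. lia.
Qed.

Lemma codes_le (k l : nat) (e : M) (rho : nat -> M) : k <= l -> codes l e rho -> codes k e rho.
Proof. intros H C i Hi. apply C. lia. Qed.

Lemma codes_scons (k : nat) (e e' x : M) (rho : nat -> M) :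
  is_opair e' x e -> codes (pred k) e rho -> codes k e' (scons x rho).
Proof.
  intros H C [|i] Hi; simpl; [eauto|].
  exists x, e. split; [exact H|]. apply C. lia.
Qed.

(** A code carries finitely many entries, so the required number [k] depends on the formula. For an
    atom, a guess for entry [i] is prepended and checked; then either the same guess is compared
    with entry [j], or [mem_rel] first replaces it by a set containing it. *)
Lemma code_satE (f : form) :
  exists k, forall e rho, codes k e rho -> (code_sat f e <-> sat E rho f).
Proof.
  induction f as [i j|i j|g [k IH]|g [k IHg] h [l IHh]|g [k IH]]; simpl.
  - exists (S (max i j)). intros e rho C.
    assert (Ci : entry i e (rho i)) by (apply C; lia).
    assert (Cj : entry j e (rho j)) by (apply C; lia).
    split.
    + intros (t & [x Ht] & Hi & (u & (x' & y & e' & Ht' & Hu & Hxy) & Hj)).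
      destruct (opair_inj _ _ _ _ _ Ht Ht') as [<- <-].
      apply (entry_classE _ _ _ _ Ht) in Hi.
      apply (entry_classE _ _ _ _ Hu) in Hj.
      now rewrite (entry_unique _ _ _ _ Ci Hi), (entry_unique _ _ _ _ Cj Hj).
    + intros H. destruct (opair_exists (rho i) e) as [t Ht].
      destruct (opair_exists (rho j) e) as [u Hu].
      exists t. split; [now exists (rho i)|]. split.
      * now apply (entry_classE _ _ _ _ Ht).
      * exists u. split; [|now apply (entry_classE _ _ _ _ Hu)].
        now exists (rho i), (rho j), e.
  - exists (S (max i j)). intros e rho C.
    assert (Ci : entry i e (rho i)) by (apply C; lia).
    assert (Cj : entry j e (rho j)) by (apply C; lia).
    split.
    + intros (t & [x Ht] & Hi & Hj).
      apply (entry_classE _ _ _ _ Ht) in Hi.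
      apply (entry_classE _ _ _ _ Ht) in Hj.
      now rewrite (entry_unique _ _ _ _ Ci Hi), (entry_unique _ _ _ _ Cj Hj).
    + intros H. destruct (opair_exists (rho i) e) as [t Ht].
      exists t. split; [now exists (rho i)|].
      split; apply (entry_classE _ _ _ _ Ht); congruence.
  - exists k. intros e rho C. now rewrite (IH e rho C).
  - exists (max k l). intros e rho C.
    rewrite (IHg e rho), (IHh e rho);
      [reflexivity| |]; eapply codes_le; try exact C; lia.
  (* The quantified element supplies the first of the [k] entries used by the body. *)
  - exists (pred k). intros e rho C. split.
    + intros H x. destruct (opair_exists x e) as [u Hu].
      apply (IH u _ (codes_scons _ _ _ _ _ Hu C)), NNPP. intros N.
      apply H. exists u. split; [now exists x|exact N].
    + intros H (u & [x Hu] & N). apply N.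
      now apply (IH u _ (codes_scons _ _ _ _ _ Hu C)).
Qed.

Lemma definable_entry_class (n : nat) : definable E (fun rho => entry_class n (rho 0)).
Proof.
  induction n as [|n IH]; simpl; apply definable_diamond.
  - apply definable_head_rel.
  - apply (definable_ext _ (fun rho => rho 0 = rho 0)); [tauto|apply definable_eq].
  - apply definable_drop_rel.
  - exact IH.
Qed.

Lemma definable_code_sat (f : form) : definable E (fun rho => code_sat f (rho 0)).
Proof.
  induction f as [i j|i j|g IH|g IHg h IHh|g IH]; simpl;
    auto 6 using definable_not, definable_and, definable_diamond,
      definable_entry_class, definable_ext_rel, definable_mem_rel.
Qed.

(** * Gaifman's argument *)

Definition subset3 (a b _ : M) : Prop := forall z, E z a -> E z b.

Definition diff3 (c a b : M) : Prop := forall z, E z c <-> E z a /\ ~ E z b.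

Definition preimage3 (g : M -> M -> Prop) (c a d : M) : Prop :=
  forall t, E t c <-> E t a /\ exists u, E u d /\ g t u.

(** The fixed arity three lets one notion serve membership, pairing and the set operations alike. *)
Definition preserves (R : M -> M -> Prop) (P : M -> M -> M -> Prop) : Prop :=
  forall a b c a' b' c', R a a' -> R b b' -> R c c' -> P a b c -> P a' b' c'.

(** A finite conjunction, hence a single formula when [R] is definable, whereas elementarity
    quantifies over all formulas. *)
Definition preserves_basic (R : M -> M -> Prop) : Prop :=
  preserves R (fun a b _ => E a b) /\
  preserves R is_opair /\
  preserves R subset3 /\
  preserves R diff3 /\
  preserves R (preimage3 ext_rel) /\
  preserves R (preimage3 drop_rel) /\
  preserves R (preimage3 mem_rel) /\
  preserves R (preimage3 head_rel).

Definition good (R : M -> M -> Prop) (Q : M -> Prop) : Prop :=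
  forall A A' C C', R A A' -> R C C' -> is_inter C A Q -> is_inter C' A' Q.

Section Gaifman.
Context (R : M -> M -> Prop).
Hypothesis Rfun : is_function R.
Hypothesis Rcof : cofinal E R.
Hypothesis Rpres : preserves_basic R.

Lemma image_unique (x y y' : M) : R x y -> R x y' -> y = y'.
Proof.
  intros H H'. destruct (Rfun x) as [z [_ Hz]]. now rewrite (Hz _ H), (Hz _ H').
Qed.

Lemma image_exists (x : M) : exists y, R x y.
Proof. destruct (Rfun x) as [y [H _]]. now exists y. Qed.

Lemma good_True : good R (fun _ => True).
Proof.
  intros A A' C C' HA HC H.
  assert (C = A) as ->
    by (apply (zf_ext _ _ HZF); intros z; rewrite (H z); tauto).
  rewrite (image_unique _ _ _ HC HA). intros t. tauto.
Qed.

(** The part of [A] outside [Q] is the difference of [A] and [A ∩ Q], and [R] preserves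
    differences. *)
Lemma good_not (Q : M -> Prop) :
  definable E (fun rho => Q (rho 0)) -> good R Q -> good R (fun t => ~ Q t).
Proof.
  intros D G A A' C C' HA HC H.
  destruct (inter_exists Q A D) as [B HB].
  destruct (image_exists B) as [B' HB'].
  assert (K := G _ _ _ _ HA HB' HB).
  assert (L : diff3 C' A' B').
  { destruct Rpres as (_ & _ & _ & P & _). apply (P C A B); auto.
    intros z. rewrite (H z), (HB z). tauto. }
  intros t. rewrite (L t), (K t). tauto.
Qed.

Lemma good_and (P Q : M -> Prop) :
  definable E (fun rho => P (rho 0)) ->
  good R P -> good R Q -> good R (fun t => P t /\ Q t).
Proof.
  intros D GP GQ A A' C C' HA HC H.
  destruct (inter_exists P A D) as [B HB].
  destruct (image_exists B) as [B' HB'].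
  assert (K := GP _ _ _ _ HA HB' HB).
  assert (L : is_inter C' B' Q).
  { apply (GQ B B' C C'); auto. intros z. rewrite (H z), (HB z). tauto. }
  intros t. rewrite (L t), (K t). tauto.
Qed.

(** Collection bounds the witnesses by a set, which turns [diamond g Q] on [A] into a [preimage3]
    that [R] preserves; cofinality brings arbitrary witnesses for elements of [A'] under such a
    bound. *)
Lemma good_diamond (g : M -> M -> Prop) (Q : M -> Prop) :
  definable E (fun rho => g (rho 0) (rho 1)) ->
  definable E (fun rho => Q (rho 0)) ->
  preserves R (preimage3 g) ->
  good R Q -> good R (diamond g Q).
Proof.
  intros Dg DQ P G A A' C C' HA HC H.
  (* An implication makes the relation total on [A]; where the diamond fails, [t] itself is the
     default value. *)
  destruct (collection (fun t u => diamond g Q t -> g t u /\ Q u) A) as [B HB].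
  { apply definable_imp; [now apply definable_diamond|].
    apply definable_and; [exact Dg|]. now apply definable_ren1. }
  { intros t _. destruct (classic (diamond g Q t)) as [[u K]|K].
    - now exists u.
    - exists t. tauto. }
  (* Every superset of the collecting set [B] computes [A ∩ diamond g Q]. *)
  assert (key : forall B1 B1', (forall z, E z B -> E z B1) -> R B1 B1' ->
            forall t, E t C' <-> E t A' /\ exists u, (E u B1' /\ Q u) /\ g t u).
  { intros B1 B1' S1 HB1.
    destruct (inter_exists Q B1 DQ) as [D HD].
    destruct (image_exists D) as [D' HD'].
    assert (K := G _ _ _ _ HB1 HD' HD).
    assert (L : preimage3 g C' A' D').
    { apply (P C A D); auto. intros t. rewrite (H t). split.
      - intros [Ht Hd]. split; [exact Ht|].
        destruct (HB t Ht) as [u [Hu K1]]. destruct (K1 Hd) as [K2 K3].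
        exists u. split; [|exact K2]. apply HD. auto.
      - intros [Ht [u [Hu Hg]]]. split; [exact Ht|].
        exists u. apply HD in Hu. tauto. }
    intros t. rewrite (L t).
    split; intros [Ht [u [Hu Hg]]]; (split; [exact Ht|]); exists u;
      (split; [|exact Hg]); now apply K. }
  intros t. split.
  - intros Ht. destruct (image_exists B) as [B' HB'].
    apply (key B B' (fun z h => h) HB') in Ht.
    destruct Ht as [Ht [u [[_ Hu] Hg]]]. split; [exact Ht|]. now exists u.
  - intros [Ht [u [Hg Hu]]].
    (* The witness [u] may lie outside the image of [B], so [B] is enlarged by a set [c] whose image
       contains [u]. *)
    destruct (Rcof u) as (c & c' & Hc & Huc).
    destruct (superset_exists B c) as [B1 [S1 S2]].
    destruct (image_exists B1) as [B1' HB1].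
    apply (key B1 B1' S1 HB1). split; [exact Ht|].
    exists u. split; [split; [|exact Hu]|exact Hg].
    destruct Rpres as (_ & _ & Psub & _).
    exact (Psub c B1 c c' B1' c' Hc HB1 Hc S2 u Huc).
Qed.

Lemma good_entry_class (n : nat) : good R (entry_class n).
Proof.
  destruct Rpres as (_ & _ & _ & _ & _ & Pd & _ & Ph).
  induction n as [|n IH]; simpl; apply good_diamond; auto.
  - apply definable_head_rel.
  - apply (definable_ext _ (fun rho => rho 0 = rho 0)); [tauto|apply definable_eq].
  - apply good_True.
  - apply definable_drop_rel.
  - apply definable_entry_class.
Qed.

Lemma good_code_sat (f : form) : good R (code_sat f).
Proof.
  destruct Rpres as (_ & _ & _ & _ & Pe & _ & Pm & _).
  induction f as [i j|i j|g IH|g IHg h IHh|g IH]; simpl;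
    auto 8 using good_not, good_and, good_diamond, good_entry_class,
      definable_not, definable_and, definable_diamond, definable_entry_class,
      definable_ext_rel, definable_mem_rel, definable_code_sat.
Qed.

(** Preservation of ordered pairs carries over each stage of the unpacking of [e]. *)
Lemma image_codes (k : nat) (e e' : M) (rho sigma : nat -> M) :
  R e e' -> (forall n, R (rho n) (sigma n)) -> codes k e rho -> codes k e' sigma.
Proof.
  intros He Hr C i Hi. generalize (C i Hi) (Hr i).
  destruct Rpres as (_ & Pp & _).
  generalize (rho i), (sigma i). clear - He Pp Rfun. revert e e' He.
  induction i as [|i IH]; simpl; intros e e' He x x' H Hx.
  - destruct H as [d Hd]. destruct (image_exists d) as [d' Hd'].
    exists d'. exact (Pp _ _ _ _ _ _ He Hx Hd' Hd).
  - destruct H as (z & d & Hd & H).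
    destruct (image_exists d) as [d' Hd'], (image_exists z) as [z' Hz'].
    exists z', d'. split; [exact (Pp _ _ _ _ _ _ He Hz' Hd' Hd)|].
    exact (IH d d' Hd' x x' H Hx).
Qed.

(** If a code [e] satisfies [f], its singleton lies within the good class [code_sat f]; so does the
    image of the singleton, which contains the image of [e]. *)
Lemma cofinal_elementary : elementary E R.
Proof.
  assert (F : forall f rho sigma, (forall n, R (rho n) (sigma n)) ->
            sat E rho f -> sat E sigma f).
  { intros f rho sigma Hr Hs.
    destruct (code_satE f) as [k Hk].
    destruct (codes_exists k rho) as [e He].
    destruct (image_exists e) as [e' He'].
    assert (Ce := image_codes _ _ _ _ _ He' Hr He).
    apply (Hk _ _ He) in Hs. apply (Hk _ _ Ce).
    destruct (upair_exists e e) as [A HA].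
    destruct (image_exists A) as [A' HA'].
    assert (I : is_inter A A (code_sat f)).
    { intros t. split; [|tauto]. intros Ht. split; [exact Ht|].
      apply HA in Ht. destruct Ht as [->| ->]; exact Hs. }
    apply (good_code_sat f _ _ _ _ HA' HA' I e').
    destruct Rpres as (PE & _).
    apply (PE e A e e' A' e'); auto. apply HA. auto. }
  intros f rho sigma Hr. split.
  - now apply F.
  (* The converse is the forward direction for the negated formula. *)
  - intros Hs. apply NNPP. intros N. exact (F (FNeg f) rho sigma Hr N Hs).
Qed.

End Gaifman.

(** * First-order expressibility of [Gamma] and of the class of moved sets *)

Lemma elementary_preserves (R : M -> M -> Prop) (P : M -> M -> M -> Prop) :
  elementary E R -> definable E (fun rho => P (rho 0) (rho 1) (rho 2)) ->
  preserves R P.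
Proof.
  intros HE [psi K] a b c a' b' c' Ha Hb Hc H.
  apply (K (scons a' (scons b' (fun _ => c')))).
  apply (HE psi (scons a (scons b (fun _ => c)))).
  - intros [|[|n]]; assumption.
  - now apply K.
Qed.

Lemma definable_subset3 : definable E (fun rho => subset3 (rho 0) (rho 1) (rho 2)).
Proof. unfold subset3. definability. Qed.

Lemma definable_diff3 : definable E (fun rho => diff3 (rho 0) (rho 1) (rho 2)).
Proof. unfold diff3. definability. Qed.

Lemma definable_preimage3 (g : M -> M -> Prop) :
  (forall i j, definable E (fun rho => g (rho i) (rho j))) ->
  definable E (fun rho => preimage3 g (rho 0) (rho 1) (rho 2)).
Proof.
  intros Hg. unfold preimage3.
  definability. apply (Hg 1 0).
Qed.

Lemma elementary_preserves_basic (R : M -> M -> Prop) :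
  elementary E R -> preserves_basic R.
Proof.
  intros HE. unfold preserves_basic.
  repeat apply conj; apply elementary_preserves; auto using definable_in, definable_opair,
    definable_subset3, definable_diff3, definable_preimage3, definable_ext_rel,
    definable_drop_rel, definable_mem_rel, definable_head_rel.
Qed.

Lemma definable_preserves (phi : form) (P : M -> M -> M -> Prop) :
  definable E (fun rho => P (rho 0) (rho 1) (rho 2)) ->
  definable E (fun rho => preserves (defrel E phi (rho 0)) P).
Proof.
  intros HP. unfold preserves. definability; now apply definable_ren3.
Qed.

Definition Gamma (phi : form) (q : M) : Prop :=
  is_function (defrel E phi q) /\ cofinal E (defrel E phi q) /\
  preserves_basic (defrel E phi q).

Lemma definable_Gamma (phi : form) : definable E (fun rho => Gamma phi (rho 0)).
Proof.
  unfold Gamma, is_function, cofinal, preserves_basic.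
  definability; apply definable_preserves;
    auto using definable_in, definable_opair,
      definable_subset3, definable_diff3, definable_preimage3, definable_ext_rel,
      definable_drop_rel, definable_mem_rel, definable_head_rel.
Qed.

(** Quantifying over [q] removes the parameter, so that every embedding under consideration respects
    this class. *)
Definition moved (phi : form) (x : M) : Prop :=
  exists q y, Gamma phi q /\ defrel E phi q x y /\ y <> x.

Lemma definable_moved (phi : form) : definable E (fun rho => moved phi (rho 0)).
Proof.
  unfold moved. definability. apply (definable_ren1 _ (Gamma phi) 1), definable_Gamma.
Qed.

End SetTheory.

Theorem theorem3p3 (M : Type) (E : M -> M -> Prop) (HZF : ZFminus M E)
    (phi : form) (p : M) :
  ~ (is_function (defrel E phi p) /\
     elementary E (defrel E phi p) /\
     nontrivial (defrel E phi p) /\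
     cofinal E (defrel E phi p)).
Proof.
  intros (Hfun & Hel & (x0 & y0 & Hxy0 & Hne0) & Hcof).
  set (W := moved (E := E) phi).
  destruct (foundation HZF W) as [x [(q & y & (Qfun & Qcof & Qpres) & Hxy & Hne) Hmin]].
  - apply definable_moved.
  - exists x0, p, y0. split; [|auto].
    split; [exact Hfun|split; [exact Hcof|]].
    now apply elementary_preserves_basic.
  - assert (Qel := cofinal_elementary HZF _ Qfun Qcof Qpres).
    assert (fixed : forall z, ~ W z -> defrel E phi q z z).
    { intros z Hz. destruct (Qfun z) as [z' [Hz' _]].
      destruct (classic (z' = z)) as [<-|N]; [exact Hz'|].
      destruct Hz. exists q, z'. split; [|auto]. now split. }
    (* Disjointness from the parameter-free class [W] is a first-order property of [x] alone, so it
       passes to the image [y]. *)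
    assert (Hminy : forall z, E z y -> ~ W z).
    { assert (D : definable E (fun rho => forall z, E z (rho 0) -> ~ W z)).
      { definability. apply definable_moved. }
      destruct D as [psi K].
      apply (K (fun _ => y)), (Qel psi (fun _ => x)); [auto|]. now apply K. }
    apply Hne, (zf_ext _ _ HZF). intros z.
    (* The embedding fixes [z] and sends [x] to [y], so elementarity for the membership atom
       applies. *)
    assert (same : ~ W z -> (E z x <-> E z y)).
    { intros Hz. apply (Qel (FIn 0 1) (scons z (fun _ => x)) (scons z (fun _ => y))).
      intros [|n]; simpl; auto. }
    split; intros Hz; apply same; auto.
Qed.
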